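(* Let $p$ be a prime and let $G$ be a finite $p$-group. Assume that $\{1\}$ and $G$ are the only normal subgroups of $G$ that are comparable (with respect to $\subseteq$) to all other normal subgroups of $G$. Then the following are equivalent: (1) The clone of congruence preserving functions of $G$ is not finitely generated. (2) $G$ is not cyclic, and there exist normal subgroups $E,D$ of $G$ such that $E\neq\{1\}$, $D\neq G$, and every normal subgroup $I$ of $G$ satisfies $I\supseteq E$ or $I\subseteq D$.
   Context: A function $f:G^k\to G$ is congruence preserving if for all $(g_1,\dots,g_k),(h_1,\dots,h_k)\in G^k$ the element $f(g_1,\dots,g_k)^{-1}f(h_1,\dots,h_k)$ lies in the normal subgroup of $G$ generated by $\{g_1^{-1}h_1,\dots,g_k^{-1}h_k\}$ (equivalently, $f$ preserves every congruence of the group $G$). The congruence preserving functions of all arities $k\ge1$ form a clone on $G$ (a set of finitary operations containing all projections and closed under composition). It is finitely generated if it has a finite subset $F$ such that each of its members is a composition of projections and functions in $F$. *)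

(* Defs.v *)
From HB Require Import structures.
From mathcomp Require Import all_boot all_order all_fingroup all_solvable.

Set Implicit Arguments.
Unset Strict Implicit.
Unset Printing Implicit Defensive.

Local Open Scope group_scope.

Section Clones.

Variable T : finType.

Definition operation (k : nat) := {ffun k.-tuple T -> T}.

Definition proj k (i : 'I_k) : operation k := [ffun x => tnth x i].

Definition comp n k (f : operation n) (g : 'I_n -> operation k) : operation k :=
  [ffun x => f [tuple g i x | i < n]].

Definition opset := forall k : nat, operation k -> Prop.

(* Clones contain no operations of arity 0. *)
Definition is_clone (C : opset) : Prop :=
  [/\ forall k (f : operation k), C k f -> 0 < k,
      forall k (i : 'I_k), C k (proj i)
    & forall n k (f : operation n) (g : 'I_n -> operation k),
        C n f -> (forall i, C k (g i)) -> C k (comp f g)].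

(* When all members of F have positive arity, so do all generated operations,
   since an operation of arity 0 could only be a composition f(g_1, ..., g_n)
   with n > 0 and g_1 already generated of arity 0. *)
Inductive generated (F : opset) : forall k, operation k -> Prop :=
| generated_mem k (f : operation k) : F k f -> generated F f
| generated_proj k (i : 'I_k) : generated F (proj i)
| generated_comp n k (f : operation n) (g : 'I_n -> operation k) :
    generated F f -> (forall i, generated F (g i)) -> generated F (comp f g).

Definition finitely_generated (C : opset) : Prop :=
  exists F : seq {k : nat & operation k},
    (forall u, u \in F -> C (tag u) (tagged u)) /\
    (forall k (f : operation k), C k f ->
       generated (fun n (g : operation n) => Tagged operation g \in F) f).

End Clones.

Section CongruencePreserving.

Variable gT : finGroupType.

Definition normal_closure (A : {set gT}) : {set gT} :=
  <<class_support A [set: gT]>>.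

Lemma normal_closure_normal (A : {set gT}) : normal_closure A <| [set: gT].
Proof.
by rewrite /normal /normal_closure subsetT norms_gen // class_support_norm.
Qed.

Lemma normal_closure_min (A : {set gT}) (N : {group gT}) :
  N <| [set: gT] -> (normal_closure A \subset N) = (A \subset N).
Proof.
case/andP=> _ nN; rewrite gen_subG; apply/idP/idP; last first.
  by move=> sAN; apply: class_support_sub_norm.
by apply: subset_trans; apply: sub_class_support.
Qed.

Definition congruence_preserving k (f : operation gT k) : Prop :=
  forall x y : k.-tuple gT,
    (f x)^-1 * f y \in
      normal_closure [set (tnth x i)^-1 * tnth y i | i : 'I_k].

Definition congruence_preserving_functions : opset gT :=
  fun k f => 0 < k /\ congruence_preserving f.

Lemma congruence_preserving_clone : is_clone congruence_preserving_functions.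
Proof.
split=> [k f [] //|k i|n k f g [n_gt0 cf] cg].
  split; first exact: leq_ltn_trans (ltn_ord i).
  move=> x y; rewrite !ffunE; apply/mem_gen.
  by apply: (subsetP (sub_class_support _ _)); apply/imsetP; exists i.
have [k_gt0 _] := cg (Ordinal n_gt0); split=> // x y; rewrite !ffunE.
apply: subsetP (cf _ _).
have nN := normal_closure_normal [set (tnth x i)^-1 * tnth y i | i : 'I_k].
rewrite (normal_closure_min _ (N := <<_>>%G) nN).
apply/subsetP=> _ /imsetP[i _ ->]; rewrite !tnth_mktuple.
by have [_] := cg i; apply.
Qed.

End CongruencePreserving.

(* Main.v *)
Require Import Defs.
From HB Require Import structures.
From mathcomp Require Import all_boot all_order all_fingroup all_solvable.
From mathcomp Require Import all_algebra finfield boolp ring.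

(** Write G for the group and say that two normal subgroups E <> 1 and D <> G
    split the lattice of normal subgroups when each of its members contains E or
    is contained in D.

    If no pair splits the lattice, then in some arity k only the constant 1 is an
    absorbing congruence preserving function, that is, one taking the value 1
    as soon as one argument is 1.  Otherwise one picks a finite list X
    of elements such that for every k some absorbing function does not vanish
    at X followed by k further arguments, and such that the normal subgroup D
    of those a for which X, a no longer has this property is as large as
    possible.  Every a outside D can then be appended to X without changing D,
    so all of them can be appended together, and a nontrivial value of an
    absorbing function at the resulting list lies in the normal closure of each
    a outside D.  The normal closure E of that value and D split the lattice
    ([never_vanishing_splits]).  Once absorbing functions of large arity are
    trivial, every operation of large arity is a product of operations each of
    which ignores a variable, hence comes from a smaller arity, and the clone is
    generated by its operations of bounded arity
    ([term_of_absorbing]).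

    If G is cyclic, its normal subgroups form a chain, so G is simple or
    trivial, every operation is congruence preserving, and operations of
    arity at most 2 generate all operations ([term_simple]).

    If G is not cyclic, the clone acts on G like a nilpotent structure.  Call z
    a socle element modulo a normal subgroup N when z is central of order
    dividing p modulo N.  A congruence preserving h with h(1) = 1 is, on the
    socle elements modulo N, the map z |-> z^c modulo N with an exponent c that
    is the same for all N ([socle_exponent]).  Two independent central elements
    of order p determine c; dividing by z^c, the normal subgroups on which the
    socle elements are killed contain a nontrivial one, and a maximal one of
    them is comparable with every normal subgroup, hence is G.  Consequently,
    for an operation f of arity k, multiplying the i-th argument by a socle
    element z multiplies the value by z^c_i modulo N, and c_i does not depend on
    the arguments, since G is generated by two maximal subgroups
    ([coordinate_exponent]).

    Along a chief series this says that each F_p-valued coordinate of f is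
    linear in the same coordinate of the arguments, up to a function of the
    coordinates further up in the series.  Say that a function has degree at
    most d if it is a sum of functions depending on at most d variables each.
    For finitely many generators the correction terms have bounded degree, and
    going down the series one gets a bound d for the degree of all generated
    operations of all arities ([bounded_degree_all]).  But if E, D split the
    lattice, every function that depends only on the cosets of D and takes its
    values in E is congruence preserving; the one that equals a fixed e <> 1
    when all d + 1 arguments lie outside D, and 1 otherwise, is not of degree at
    most d, because an alternating sum over a cube separates it from the
    functions that ignore a variable ([junta_alternating_sum]). So the clone is
    not finitely generated ([split_not_finitely_generated]). *)

Set Implicit Arguments.
Unset Strict Implicit.
Unset Printing Implicit Defensive.

Local Open Scope group_scope.

(** * Congruence preserving functions *)

Section CPOperations.

Variable gT : finGroupType.
Implicit Types N : {group gT}.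

Lemma congruence_preservingP k (f : operation gT k) :
  congruence_preserving f <->
  (forall N, N <| [set: gT] -> forall x y : k.-tuple gT,
     (forall i, (tnth x i)^-1 * tnth y i \in N) -> (f x)^-1 * f y \in N).
Proof.
split=> [cf N nN x y xyN | cf x y].
  apply: subsetP (cf x y); rewrite normal_closure_min //.
  by apply/subsetP=> _ /imsetP[i _ ->].
apply: (cf <<_>>%G (normal_closure_normal _)) => i.
by apply/mem_gen/(subsetP (sub_class_support _ _))/imsetP; exists i.
Qed.

Definition cp_fun (h : gT -> gT) : Prop :=
  forall N, N <| [set: gT] ->
  forall x y, x^-1 * y \in N -> (h x)^-1 * h y \in N.

Lemma normal_conj N x y : N <| [set: gT] -> (x ^ y \in N) = (x \in N).
Proof. by case/andP=> _ nN; rewrite memJ_norm // (subsetP nN) ?inE. Qed.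

Lemma cong_inv N x y : N <| [set: gT] ->
  (x^-1)^-1 * y^-1 \in N = (x^-1 * y \in N).
Proof.
move=> nN; rewrite -groupV invMg !invgK -(normal_conj _ x nN).
by rewrite conjgE -!mulgA mulVg mulg1.
Qed.

Lemma cong_mul N x y x' y' : N <| [set: gT] ->
  x^-1 * y \in N -> x'^-1 * y' \in N -> (x * x')^-1 * (y * y') \in N.
Proof.
move=> nN xy xy'.
have ->: (x * x')^-1 * (y * y') = (x^-1 * y) ^ x' * (x'^-1 * y').
  by rewrite conjgE invMg !mulgA mulgK.
by rewrite groupM // normal_conj.
Qed.

Lemma cong_trans N y x z : x^-1 * y \in N -> y^-1 * z \in N -> x^-1 * z \in N.
Proof.
move=> xy yz; have ->: x^-1 * z = (x^-1 * y) * (y^-1 * z) by rewrite !mulgA mulgK.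
exact: groupM.
Qed.

Lemma cong_sym N x y : x^-1 * y \in N -> y^-1 * x \in N.
Proof. by rewrite -groupV invMg invgK. Qed.

End CPOperations.

Section Generation.

Variable gT : finGroupType.

Definition cp_upto (m : nat) : seq {k : nat & operation gT k} :=
  [seq Tagged (operation gT) f | k <- iota 1 m,
     f : operation gT k <- [seq f <- enum {: operation gT k} | `[< congruence_preserving f >]]].

Lemma mem_cp_upto m k (f : operation gT k) :
  (Tagged (operation gT) f \in cp_upto m) <->
  [/\ 0 < k, k <= m & congruence_preserving f].
Proof.
split.
  case/allpairsPdep=> k' [f' [k'm f'cp e]].
  have ek : k = k' by exact: (congr1 (@tag _ _) e).
  subst k'; move/eqP: e; rewrite eq_Tagged => /eqP /= ef.
  subst f'; move: k'm f'cp; rewrite mem_iota mem_filter add1n ltnS => /andP[-> ->].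
  by case/andP=> /asboolP.
case=> k0 km cf; apply/allpairsPdep; exists k, f; split=> //.
  by rewrite mem_iota k0 add1n ltnS.
by rewrite mem_filter mem_enum andbT; apply/asboolP.
Qed.

End Generation.

(** * Generation by operations of bounded arity *)

Section FromBoundedArity.

Variables (gT : finGroupType) (m : nat).
Hypothesis m_gt1 : 1 < m.

Definition term k (f : operation gT k) : Prop :=
  Defs.generated (fun n (g : operation gT n) => Tagged (operation gT) g \in cp_upto gT m) f.

Lemma finitely_generated_upto :
  (forall k (f : operation gT k), m < k -> congruence_preserving f -> term f) ->
  finitely_generated (@congruence_preserving_functions gT).
Proof.
move=> genP; exists (cp_upto gT m); split.
  by case=> k f /mem_cp_upto[].
move=> k f [k_gt0 cf]; case: (ltnP m k) => [/genP|km]; first exact.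
by apply/generated_mem/mem_cp_upto.
Qed.

Lemma term_binop (b : gT -> gT -> gT) k (f g : operation gT k) :
  congruence_preserving [ffun x : 2.-tuple gT => b (tnth x ord0) (tnth x ord_max)] ->
  term f -> term g -> term [ffun x => b (f x) (g x)].
Proof.
move=> cb tf tg.
have tb : term [ffun x : 2.-tuple gT => b (tnth x ord0) (tnth x ord_max)].
  by apply/generated_mem/mem_cp_upto.
pose fg (i : 'I_2) := if i == ord0 then f else g.
have -> : [ffun x => b (f x) (g x)] =
          Defs.comp [ffun x : 2.-tuple gT => b (tnth x ord0) (tnth x ord_max)] fg.
  by apply/ffunP=> x; rewrite !ffunE !tnth_mktuple.
by apply: generated_comp tb _ => i; rewrite /fg; case: ifP.
Qed.

Lemma term_mul k (f g : operation gT k) :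
  term f -> term g -> term [ffun x => f x * g x].
Proof.
apply: term_binop; apply/congruence_preservingP=> N nN x y xy.
by rewrite !ffunE cong_mul.
Qed.

Lemma term_const k (c : gT) : 0 < k -> term ([ffun => c] : operation gT k).
Proof.
case: k => // k _.
have tc : term ([ffun => c] : operation gT 1).
  apply/generated_mem/mem_cp_upto; split=> //; first exact: ltnW.
  by apply/congruence_preservingP=> N nN x y _; rewrite !ffunE mulVg group1.
have -> : [ffun => c] = Defs.comp ([ffun => c] : operation gT 1)
                          (fun=> proj gT (ord0 : 'I_k.+1)).
  by apply/ffunP=> x; rewrite !ffunE.
by apply: generated_comp tc _ => i; apply: generated_proj.
Qed.

(** The indicator of a point is a chain of binary tests, one for each coordinate,
    and every operation is a product of multiples of such indicators. When all
    operations preserve congruences, the binary ones needed here are at hand. *)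
Lemma term_simple k (f : operation gT k) :
  (forall n (g : operation gT n), congruence_preserving g) -> 0 < k -> term f.
Proof.
move=> allcp k_gt0.
have ind (a : k.-tuple gT) c (s : seq 'I_k) :
  term [ffun x => if all (fun i => tnth x i == tnth a i) s then c else 1].
  elim: s => [|i s IHs]; first exact: term_const.
  pose b u v : gT := if v == tnth a i then u else 1.
  have := term_binop (b := b) (allcp _ _) IHs (generated_proj _ i).
  by congr term; apply/ffunP=> x; rewrite !ffunE /b /=; case: eqP.
have {}ind a c : term [ffun x : k.-tuple gT => if x == a then c else 1].
  have := ind a c (enum 'I_k); congr term; apply/ffunP=> x; rewrite !ffunE.
  congr (if _ then _ else _); apply/allP/eqP=> [eqxa|-> //].
  by apply: eq_from_tnth => i; apply/eqP/eqxa; rewrite mem_enum.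
have prod (s : seq (k.-tuple gT)) : uniq s ->
  term [ffun x => if x \in s then f x else 1].
  elim: s => [|a s IHs] /=; first by move=> _; apply: term_const.
  case/andP=> a_s /IHs /(term_mul (ind a (f a))); congr term.
  apply/ffunP=> x; rewrite !ffunE inE; case: eqP => [->|_]; last by rewrite mul1g.
  by rewrite (negPf a_s) mulg1.
have := prod _ (enum_uniq {: k.-tuple gT}); congr term.
by apply/ffunP=> x; rewrite !ffunE mem_enum.
Qed.

Definition put1 n (f : operation gT n) (i : 'I_n) : operation gT n :=
  [ffun x => f [tuple if j == i then 1 else tnth x j | j < n]].

Lemma put1_cp n (f : operation gT n) i :
  congruence_preserving f -> congruence_preserving (put1 f i).
Proof.
move/congruence_preservingP=> cf; apply/congruence_preservingP=> N nN x y xy.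
rewrite !ffunE; apply: cf => // j; rewrite !tnth_mktuple.
by case: ifP; rewrite // mulVg group1.
Qed.

(** The operation [put1 f i] keeps the arity of [f] but ignores its [i]-th argument,
    so it is an operation of one arity less, composed with projections. *)
Lemma put1_term n (f : operation gT n.+2) i :
  (forall g : operation gT n.+1, congruence_preserving g -> term g) ->
  congruence_preserving f -> term (put1 f i).
Proof.
move=> IH cf.
pose g : operation gT n.+1 :=
  [ffun y => f [tuple if unlift i j is Some j' then tnth y j' else 1 | j < n.+2]].
have cg : congruence_preserving g.
  move/congruence_preservingP: cf => cf; apply/congruence_preservingP=> N nN x y xy.
  rewrite !ffunE; apply: cf => // j; rewrite !tnth_mktuple.
  by case: unliftP => [j'|] _; rewrite ?mulVg ?group1.
have -> : put1 f i = Defs.comp g (fun j => proj gT (lift i j)).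
  apply/ffunP=> x; rewrite !ffunE; congr (f _); apply: eq_from_tnth => j.
  rewrite !tnth_mktuple; case: unliftP => [j'|] -> /=; last by rewrite eqxx.
  by rewrite eq_sym (negPf (neq_lift _ _)) tnth_mktuple ffunE.
by apply: generated_comp (IH _ cg) _ => j; apply: generated_proj.
Qed.

Definition absorbing_at n (f : operation gT n) (i : 'I_n) : Prop :=
  forall x, tnth x i = 1 -> f x = 1.

(** Dividing [g] by [put1 g i] makes it absorbing at [i] and keeps it absorbing
    wherever it was; the divisor is a term by the induction hypothesis on
    arities, so nothing is lost for generation. *)
Lemma absorbing_part n (f : operation gT n.+2) (s : seq 'I_n.+2) :
  (forall g : operation gT n.+1, congruence_preserving g -> term g) ->
  congruence_preserving f ->
  exists g : operation gT n.+2,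
    [/\ congruence_preserving g, {in s, forall i, absorbing_at g i}
      & term g -> term f].
Proof.
move=> IH cf; elim: s => [|i s [g [cg ag tg]]]; first by exists f.
exists [ffun x => (put1 g i x)^-1 * g x]; split.
- have /congruence_preservingP cp := put1_cp i cg.
  move/congruence_preservingP: cg => cg; apply/congruence_preservingP=> N nN x y xy.
  rewrite [X in X^-1 * _]ffunE [X in _ * X]ffunE.
  by rewrite cong_mul ?cong_inv ?cp ?cg.
- move=> j; rewrite inE => /orP[/eqP->|js] x xj; rewrite !ffunE.
    rewrite (_ : [tuple _ | _ < _] = x) ?mulVg //.
    by apply: eq_from_tnth => j'; rewrite tnth_mktuple; case: eqP => // ->.
  rewrite !(ag _ js) ?mulg1 ?invg1 // tnth_mktuple xj.
  by case: ifP.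
move=> t; apply: tg; have := term_mul (put1_term i IH cg) t; congr term.
by apply/ffunP=> x; rewrite !ffunE mulKVg.
Qed.

(** The absorbing part of an operation of large arity is trivial, so the operation
    is a product of operations of smaller arity. *)
Lemma term_of_absorbing :
  (forall n (g : operation gT n), m < n -> congruence_preserving g ->
     (forall i, absorbing_at g i) -> forall x, g x = 1) ->
  forall k (f : operation gT k), 0 < k -> congruence_preserving f -> term f.
Proof.
move=> vanish; elim=> // n IHn f _ cf.
case: (ltnP m n.+1) => [mn|nm]; last by apply/generated_mem/mem_cp_upto.
case: n IHn f cf mn => [|n] IHn f cf mn; first by case: m m_gt1 mn.
have [|g [cg ag]] := absorbing_part (enum 'I_n.+2) _ cf.
  by move=> g; apply: IHn.
apply; have -> : g = [ffun => 1]; last exact: term_const.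
apply/ffunP=> x; rewrite ffunE; apply: vanish => // i.
by apply: ag; rewrite mem_enum.
Qed.

End FromBoundedArity.

(** * Absorbing functions and splitting pairs *)

Section AbsorbingFunctions.

Variable gT : finGroupType.
Implicit Types (N : {group gT}) (X s x y : seq gT) (f : seq gT -> gT).

(** Functions on sequences of all lengths let arguments be inserted without
    transport between tuple types; beyond the end the default value 1 makes the
    condition hold by itself. *)
Definition cong_seq N x y :=
  size x = size y /\ forall i, (nth 1 x i)^-1 * nth 1 y i \in N.

Definition cp_seq f :=
  forall N, N <| [set: gT] ->
  forall x y, cong_seq N x y -> (f x)^-1 * f y \in N.

Definition absorbing f := forall x, 1 \in x -> f x = 1.

Lemma cong_seq_cat N x y x' y' :
  cong_seq N x y -> cong_seq N x' y' -> cong_seq N (x ++ x') (y ++ y').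
Proof.
move=> [sxy xy] [sxy' xy']; split=> [|i]; first by rewrite !size_cat sxy sxy'.
by rewrite !nth_cat sxy; case: ifP.
Qed.

Lemma cong_seq_cons N a b x y :
  a^-1 * b \in N -> cong_seq N x y -> cong_seq N (a :: x) (b :: y).
Proof. by move=> ab [sxy xy]; split=> [|[|i]] //=; rewrite sxy. Qed.

Lemma cong_seq_drop N n x y : cong_seq N x y -> cong_seq N (drop n x) (drop n y).
Proof.
by move=> [sxy xy]; split=> [|i]; rewrite ?size_drop ?sxy // !nth_drop.
Qed.

Lemma cong_seq_take N n x y : cong_seq N x y -> cong_seq N (take n x) (take n y).
Proof.
move=> [sxy xy]; split=> [|i]; first by rewrite !size_take sxy.
have [lt_in | le_ni] := ltnP i n; first by rewrite !nth_take.
by rewrite !nth_default ?mulVg ?group1 // size_take_min geq_min le_ni.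
Qed.

Definition insert_at n (a : gT) s := take n s ++ a :: drop n s.

Definition modify_at n (phi : gT -> gT) s :=
  take n s ++ phi (nth 1 s n) :: drop n.+1 s.

Lemma insert_at_cat X a y : insert_at (size X) a (X ++ y) = X ++ a :: y.
Proof. by rewrite /insert_at take_size_cat // drop_size_cat. Qed.

Lemma modify_at_cat X phi a y :
  modify_at (size X) phi (X ++ a :: y) = X ++ phi a :: y.
Proof.
rewrite /modify_at take_size_cat // nth_cat ltnn subnn /=.
by rewrite drop_cat ltnNge leqnSn /= subSnn /= drop0.
Qed.

Lemma insert_at_cp n a f :
  cp_seq f -> absorbing f ->
  cp_seq (f \o insert_at n a) /\ absorbing (f \o insert_at n a).
Proof.
move=> cf af; split=> [N nN x y xy | x x1] /=.
  apply: cf => //; apply: cong_seq_cat; first exact: cong_seq_take.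
  by apply: cong_seq_cons; [rewrite mulVg group1 | apply: cong_seq_drop].
apply: af; rewrite mem_cat inE orbCA -mem_cat cat_take_drop.
by rewrite x1 orbT.
Qed.

Lemma modify_at_cong N n phi psi x y :
  (phi (nth 1 x n))^-1 * psi (nth 1 y n) \in N -> cong_seq N x y ->
  cong_seq N (modify_at n phi x) (modify_at n psi y).
Proof.
move=> phiN xy; apply: cong_seq_cat; first exact: cong_seq_take.
by apply: cong_seq_cons; last exact: cong_seq_drop.
Qed.

Lemma modify_at_one n s :
  1 \in s -> 1 \in take n s \/ 1 \in drop n.+1 s \/ nth 1 s n = 1.
Proof.
rewrite -{1}(cat_take_drop n s) mem_cat => /orP[]; first by left.
have [lt_ns | le_sn] := ltnP n (size s); last by rewrite drop_oversize.
rewrite (drop_nth 1 lt_ns) inE => /orP[/eqP <-|]; first by right; right.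
by right; left.
Qed.

Lemma modify_at_absorbing n phi f s : absorbing f ->
  (1 \in take n s) \/ (1 \in drop n.+1 s) -> f (modify_at n phi s) = 1.
Proof.
by move=> af s1; apply: af; rewrite mem_cat inE; case: s1 => ->; rewrite ?orbT.
Qed.

(** [vanishing X k] is the element-wise form of a vanishing higher commutator
    of the elements of X followed by k copies of the whole group. *)
Definition vanishing X k : Prop :=
  forall f, cp_seq f -> absorbing f -> forall y, size y = k -> f (X ++ y) = 1.

(** Freezing one argument of an absorbing function leaves it absorbing in the
    others. *)
Lemma vanishing_insert X a Y k : vanishing (X ++ Y) k -> vanishing (X ++ a :: Y) k.
Proof.
move=> v f cf af y sy; have [cf' af'] := insert_at_cp (size X) a cf af.
by have /= := v _ cf' af' y sy; rewrite -!catA insert_at_cat.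
Qed.

Lemma vanishing_leq X k l : k <= l -> vanishing X k -> vanishing X l.
Proof.
move=> /subnKC <- v; elim: (l - k) => [|n IHn]; first by rewrite addn0.
rewrite addnS => f cf af [//|a y] [sy].
have [cf' af'] := insert_at_cp (size X) a cf af.
by have /= := IHn _ cf' af' y sy; rewrite insert_at_cat.
Qed.

(** The largest subgroup that may be appended to [X] so that the commutator with
    many copies of the group vanishes. *)
Definition annihilator X : {set gT} :=
  [set a | `[< exists k, vanishing (rcons X a) k >]].

Lemma annihilatorP X a :
  reflect (exists k, vanishing (rcons X a) k) (a \in annihilator X).
Proof. by rewrite inE; apply: asboolP. Qed.

Lemma annihilator_group_set X : group_set (annihilator X).
Proof.
apply/group_setP; split.
  by apply/annihilatorP; exists 0 => f cf af y _; rewrite af // mem_cat mem_rcons mem_head.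
move=> a b /annihilatorP[k va] /annihilatorP[l vb].
apply/annihilatorP; exists (maxn k l) => f cf af y sy; rewrite cat_rcons.
have {}va := vanishing_leq (leq_maxl k l) va.
have {}vb := vanishing_leq (leq_maxr k l) vb.
(* the quotient f(a)^-1 * f(a * t) is again absorbing, now in t *)
pose n := size X.
pose h s := (f (modify_at n (fun=> a) s))^-1 * f (modify_at n (fun t => a * t) s).
have ch : cp_seq h.
  move=> N nN x z xz; apply: cong_mul => //; first rewrite cong_inv //.
    by apply: cf => //; apply: modify_at_cong; rewrite // mulVg group1.
  apply: cf => //; apply: modify_at_cong => //.
  by rewrite cong_mul // ?mulVg ?group1 //; case: xz.
have ah : absorbing h.
  move=> s /(modify_at_one n)[s1|[s1|s1]].
  - by rewrite /h !modify_at_absorbing ?mulVg; auto.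
  - by rewrite /h !modify_at_absorbing ?mulVg; auto.
  by rewrite /h /modify_at s1 mulg1 mulVg.
have := vb h ch ah y sy; rewrite cat_rcons /h !modify_at_cat.
by have := va f cf af y sy; rewrite cat_rcons => ->; rewrite invg1 mul1g.
Qed.

Canonical annihilator_group X := Group (annihilator_group_set X).

(** Conjugating one argument is congruence preserving and fixes 1, so it turns
    absorbing functions into absorbing functions. *)
Lemma annihilator_normal X : annihilator X <| [set: gT].
Proof.
rewrite /normal subsetT; apply/subsetP=> g _; rewrite inE.
apply/subsetP=> _ /imsetP[a /annihilatorP[k va] ->].
apply/annihilatorP; exists k => f cf af y sy; rewrite cat_rcons.
pose n := size X; pose h s := f (modify_at n (conjg^~ g) s).
have := va h _ _ y sy; rewrite /h cat_rcons modify_at_cat; apply.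
  move=> N nN x z xz; apply: cf => //; apply: modify_at_cong => //.
  by rewrite -conjVg -conjMg normal_conj //; case: xz.
move=> s /(modify_at_one n)[s1|[s1|s1]]; try by rewrite modify_at_absorbing; auto.
by apply: af; rewrite mem_cat inE s1 conj1g eqxx orbT.
Qed.

Lemma annihilator_rcons X a : annihilator X \subset annihilator (rcons X a).
Proof.
apply/subsetP=> b /annihilatorP[k vb]; apply/annihilatorP; exists k.
by rewrite -!cats1 -catA; apply: vanishing_insert; rewrite cats1.
Qed.

Definition never_vanishing X := forall k, ~ vanishing X k.

(** If the annihilator were everything, a common arity for all its elements would
    make [X] itself vanish one arity higher. *)
Lemma annihilator_proper X : never_vanishing X -> annihilator X != [set: gT].
Proof.
move=> nvX; apply/eqP=> full.
have vX a : exists k, vanishing (rcons X a) k by apply/annihilatorP; rewrite full inE.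
have [k vk] := fin_all_exists vX; pose K := \max_a k a.
apply: (nvX K.+1) => f cf af [//|a y] [sy].
have := @vanishing_leq (rcons X a) (k a) K (leq_bigmax a) (vk a) f cf af y sy.
by rewrite cat_rcons.
Qed.

(** Appending an element outside the annihilator can only enlarge the annihilator,
    so by maximality it stays the same and the process can be repeated. *)
Lemma never_vanishing_cat X s :
  (forall Y, never_vanishing Y -> #|annihilator Y| <= #|annihilator X|) ->
  never_vanishing X -> {in s, forall a, a \notin annihilator X} ->
  never_vanishing (X ++ s).
Proof.
elim: s X => [|a s IHs] X maxX nvX sX; first by rewrite cats0.
have nvXa : never_vanishing (rcons X a).
  by move=> k vk; case/annihilatorP: (sX a (mem_head _ _)); exists k.
have eqD : annihilator X = annihilator (rcons X a).
  by apply/eqP; rewrite eqEcard annihilator_rcons maxX.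
rewrite -cat_rcons; apply: IHs; rewrite -?eqD // => b bs.
by apply: sX; rewrite inE bs orbT.
Qed.

Lemma never_vanishing_splits :
  never_vanishing [::] ->
  exists E D : {group gT},
    [/\ E <| [set: gT], D <| [set: gT], E :!=: 1, D :!=: [set: gT]
      & forall I : {group gT}, I <| [set: gT] -> E \subset I \/ I \subset D].
Proof.
move=> nv0.
have [X nvX maxX] : exists2 X, never_vanishing X &
    forall Y, never_vanishing Y -> #|annihilator Y| <= #|annihilator X|.
  pose P n := `[< exists2 X, never_vanishing X & #|annihilator X| = n >].
  have exP : exists n, P n by exists #|annihilator [::]|; apply/asboolP; exists [::].
  have ubP n : P n -> n <= #|gT| by move=> /asboolP[X _ <-]; apply: max_card.
  have [n /asboolP[X nvX <-] maxX] := ex_maxnP exP ubP.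
  by exists X => // Y nvY; apply: maxX; apply/asboolP; exists Y.
pose s := enum (~: annihilator X).
have sX : {in s, forall a, a \notin annihilator X}.
  by move=> a; rewrite mem_enum inE.
have [f [cf af nf]] : exists f, [/\ cp_seq f, absorbing f & f (X ++ s) != 1].
  apply: contrapT => nof; apply: (never_vanishing_cat maxX nvX sX (k := 0)).
  move=> f cf af [] // _; rewrite cats0; apply: contrapT => /eqP nf.
  by apply: nof; exists f.
set e := f (X ++ s) in nf.
exists <<class_support [set e] [set: gT]>>%G, (annihilator_group X); split.
- exact: normal_closure_normal.
- exact: annihilator_normal.
- apply: contra nf => /eqP e1; rewrite -in_set1 -[[set 1]]e1 mem_gen //.
  by apply: (subsetP (sub_class_support _ _)); rewrite set11.
- exact: annihilator_proper.
move=> I nI; case: (boolP (I \subset annihilator X)) => [|/subsetPn[a aI aD]]; first by right.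
left; rewrite [_ \subset _](normal_closure_min _ nI) sub1set.
(* replacing a by 1 in the argument list annihilates f and is invisible modulo I *)
pose z := [seq if b == a then 1 else b | b <- X ++ s].
have fz : f z = 1.
  apply: af; apply/mapP; exists a; last by rewrite eqxx.
  by rewrite mem_cat mem_enum inE aD orbT.
have := cf I nI z (X ++ s); rewrite fz invg1 mul1g; apply.
split=> [|i]; first by rewrite size_map.
have [lt_is | le_si] := ltnP i (size (X ++ s)); last first.
  by rewrite !nth_default ?size_map // mulVg group1.
rewrite (nth_map 1) //; case: eqP => [->|_]; first by rewrite invg1 mul1g.
by rewrite mulVg group1.
Qed.

(** Extended by 1 to sequences of other lengths, an absorbing operation becomes an
    absorbing function on sequences. *)
Lemma vanishing_operation k n (g : operation gT n) :
  vanishing [::] k -> k <= n -> congruence_preserving g ->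
  (forall i, absorbing_at g i) -> forall t : n.-tuple gT, g t = 1.
Proof.
move=> v0 kn /congruence_preservingP cg ag t0.
pose f s := if insub s is Some t then g t else 1.
have := vanishing_leq kn v0 (f := f); rewrite /f => v.
have := v _ _ t0 (size_tuple t0); rewrite cat0s valK; apply.
  move=> N nN y z [syz yz]; case: insubP => [t _ et|ns]; last first.
    by rewrite insubN -?syz // mulVg group1.
  case: insubP => [u _ eu|]; last by rewrite -syz -et size_tuple eqxx.
  by apply: cg => // i; rewrite !(tnth_nth 1) et eu.
move=> s s1; case: insubP => // t _ et; move: s1; rewrite -et.
by case/tnthP=> i e; apply: (ag i).
Qed.

(** Without a splitting pair absorbing operations of large arity are trivial; the
    arity 2 is included to have the group multiplication among the generators. *)
Lemma not_split_finitely_generated :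
  ~ (exists E D : {group gT},
    [/\ E <| [set: gT], D <| [set: gT], E :!=: 1, D :!=: [set: gT]
      & forall I : {group gT}, I <| [set: gT] -> E \subset I \/ I \subset D]) ->
  finitely_generated (@congruence_preserving_functions gT).
Proof.
move=> nsplit.
have [k0 vk0] : exists k, vanishing (Nil gT) k.
  by apply: contrapT => nv; apply/nsplit/never_vanishing_splits => k vk; apply: nv; exists k.
apply: (@finitely_generated_upto _ (maxn 2 k0)) => k f lt_mk cf.
apply: term_of_absorbing; rewrite ?leq_maxl ?(leq_ltn_trans _ lt_mk) //.
move=> n g lt_mn cg ag x; apply: vanishing_operation vk0 _ cg ag x.
by apply: leq_trans (ltnW lt_mn); apply: leq_maxr.
Qed.

End AbsorbingFunctions.

(** * Central sections of exponent p *)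

Section PrimePowers.

Variables (gT : finGroupType) (p : nat).
Hypothesis p_prime : prime p.
Implicit Types (H D K : {group gT}) (z : gT).

Lemma dvdn_expg_mem H z i :
  z ^+ p \in H -> z ^+ i \in H -> z \notin H -> p %| i.
Proof.
move=> zp zi; apply: contraR; rewrite -prime_coprime // => co_pi.
have [|kp ki e _] := @egcdnP p i; first exact: prime_gt0.
rewrite (eqP co_pi) in e.
rewrite -(groupMl z (groupX ki zi)) -expgM -[z in _ * z]expg1 -expgD.
by rewrite [(i * ki)%N]mulnC -e mulnC expgM groupX.
Qed.

Lemma eqn_mod_expg H z i j :
  z ^+ p \in H -> z \notin H -> (z ^+ i)^-1 * z ^+ j \in H -> i = j %[mod p].
Proof.
wlog le_ij : i j / i <= j => [IH|] zp zH.
  have [le|/ltnW le] := leqP i j; first exact: IH.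
  by move/cong_sym=> zji; symmetry; apply: IH.
rewrite -{1}(subnKC le_ij) expgD mulKg => zij; apply/esym/eqP.
by rewrite eqn_mod_dvd // (dvdn_expg_mem zp zij).
Qed.

Lemma expg_eqn_mod H z i j :
  z ^+ p \in H -> i = j %[mod p] -> (z ^+ i)^-1 * z ^+ j \in H.
Proof.
wlog le_ij : i j / i <= j => [IH|] zp eq_ij.
  have [le|/ltnW le] := leqP i j; first exact: IH.
  by apply: cong_sym; apply: IH.
rewrite -{1}(subnKC le_ij) expgD mulKg.
have /dvdnP[k ->] : p %| j - i by rewrite -eqn_mod_dvd // eq_ij.
by rewrite mulnC expgM groupX.
Qed.

(** The elements of the preimage of the subgroup of elements of order dividing
    [p] in the centre of the quotient by [D]. *)
Definition socle_mod D z := z ^+ p \in D /\ forall g, [~ z, g] \in D.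

Lemma socle_mod_sub D D' z : D \subset D' -> socle_mod D z -> socle_mod D' z.
Proof. by move=> /subsetP sDD' [zp zg]; split=> [|g]; apply: sDD'. Qed.

Lemma socle_mod_in D z : D <| [set: gT] -> z \in D -> socle_mod D z.
Proof.
move=> nD zD; split=> [|g]; first exact: groupX.
by rewrite commgEl groupM ?groupV ?normal_conj.
Qed.

Lemma socle_mod_mul D z u :
  D <| [set: gT] -> socle_mod D z -> socle_mod D u -> socle_mod D (z * u).
Proof.
move=> nD [zp zg] [up ug]; split=> [|g]; last by rewrite commMgJ groupM ?normal_conj.
have nDx x : x \in 'N(D) by apply: (subsetP (normal_norm nD)); rewrite inE.
have coset_p x : x ^+ p \in D -> coset D x ^+ p = 1.
  by move=> xp; rewrite -morphX ?nDx //= coset_id.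
have czu : commute (coset D z) (coset D u).
  by apply/commgP; rewrite -morphR ?nDx //=; apply/eqP/coset_id/zg.
apply: coset_idr; first exact: nDx.
by rewrite morphX ?nDx //= morphM ?nDx //= expgMn // !coset_p // mulg1.
Qed.

Lemma socle_mod_exp D z i :
  D <| [set: gT] -> socle_mod D z -> socle_mod D (z ^+ i).
Proof.
move=> nD sz; elim: i => [|i IHi]; first by rewrite expg0; apply: socle_mod_in.
by rewrite expgS; apply: socle_mod_mul.
Qed.

Lemma mem_cycle_join K z x : K <| [set: gT] ->
  x \in <[z]> <*> K -> exists i, (z ^+ i)^-1 * x \in K.
Proof.
move=> nK; rewrite norm_joinEl; last first.
  by apply: subset_trans (normal_norm nK); apply: subsetT.
by case/mulsgP=> _ y /cycleP[i ->] yK ->; exists i; rewrite mulKg.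
Qed.

Lemma cycle_join_normal K z :
  K <| [set: gT] -> socle_mod K z -> <[z]> <*> K <| [set: gT].
Proof.
move=> nK [_ zg]; rewrite /normal subsetT /=.
have sKJ : K \subset <[z]> <*> K := joing_subr _ _.
have zJ : z \in <[z]> <*> K by rewrite mem_gen // inE cycle_id.
apply/subsetP=> g _; rewrite inE; apply/subsetP=> _ /imsetP[x xJ ->].
have [i zx] := mem_cycle_join nK xJ; rewrite -(mulKVg (z ^+ i) x) conjMg conjXg.
apply: groupM; last by apply: (subsetP sKJ); rewrite normal_conj.
by apply: groupX; rewrite -(mulKVg z (z ^ g)) groupM // (subsetP sKJ) // zg.
Qed.

(** In the quotient [p]-group a nontrivial normal subgroup meets the centre. *)
Lemma exists_socle_mod (pG : p.-group [set: gT]) (N : {group gT}) D :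
  N <| [set: gT] -> D <| [set: gT] -> ~~ (N \subset D) ->
  exists z, [/\ z \in N, z \notin D & socle_mod D z].
Proof.
move=> nN nD nND; pose Q := [set: gT] / D.
have nDx x : x \in 'N(D) by apply: (subsetP (normal_norm nD)); rewrite inE.
have ntZ : N / D :&: 'Z(Q) != 1.
  apply: meet_center_nil; first exact/(pgroup_nil (quotient_pgroup _ pG)).
    exact: quotient_normal.
  by rewrite -subG1 quotient_sub1 // (subset_trans _ (normal_norm nD)) ?subsetT.
have pZ : p.-group (N / D :&: 'Z(Q)).
  apply: pgroupS (quotient_pgroup D pG).
  by apply: subset_trans (subsetIl _ _) (quotientS _ (subsetT _)).
have [_ pdv _] := pgroup_pdiv pZ ntZ.
have [zb /setIP[/morphimP[z _ zN ->] Zz] oz] := Cauchy p_prime pdv.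
rewrite /= in Zz oz; exists z; split=> //.
  by apply/negP=> zD; move: oz p_prime; rewrite coset_id // order1 => <-.
split=> [|g].
  apply: coset_idr; first exact: nDx.
  by rewrite morphX ?nDx //= -oz expg_order.
apply: coset_idr; first exact: nDx.
rewrite morphR ?nDx //=; apply/eqP/commgP.
by case/centerP: Zz => _; apply; apply: mem_quotient; rewrite inE.
Qed.

Lemma socle_mod_cp (h : gT -> gT) D z :
  cp_fun h -> h 1 = 1 -> D <| [set: gT] -> socle_mod D z ->
  exists i, (z ^+ i)^-1 * h z \in D.
Proof.
move=> ch h1 nD sz; apply: mem_cycle_join => //.
have := ch _ (cycle_join_normal nD sz) 1 z; rewrite h1 invg1 !mul1g; apply.
by rewrite mem_gen // inE cycle_id.
Qed.

Lemma cp_mem (h : gT -> gT) D z :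
  cp_fun h -> h 1 = 1 -> D <| [set: gT] -> z \in D -> h z \in D.
Proof.
by move=> ch h1 nD zD; have := ch D nD 1 z; rewrite h1 invg1 !mul1g; apply.
Qed.

Lemma cong_mem D x y : x^-1 * y \in D -> (y \in D) = (x \in D).
Proof.
move=> xy; apply/idP/idP => [yD|xD].
  by rewrite -(mulKVg y x) groupM // cong_sym.
by rewrite -(mulKVg x y) groupM.
Qed.

(** If [u] and [k] are independent in the quotient by the intersection,
    comparing the values at [u], [k * u] and [k] transfers vanishing from [u]
    to [k]. *)
Lemma socle_transfer (h : gT -> gT) (A B : {group gT}) u k :
  cp_fun h -> h 1 = 1 -> A <| [set: gT] -> B <| [set: gT] ->
  u \in A -> u \notin B -> socle_mod (A :&: B) u -> h u \in B ->
  k \in B -> socle_mod (A :&: B) k -> h k \in A.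
Proof.
move=> ch h1 nA nB uA uB su huB kB sk.
have nD : A :&: B <| [set: gT] by apply: normalI.
have sAB_A := subsetIl A B; have sAB_B := subsetIr A B.
have kuB : u^-1 * (k * u) \in B by rewrite -conjgE normal_conj.
have skuD := socle_mod_mul nD sk su.
have [i hku] := socle_mod_cp ch h1 nD skuD.
(* the value at [k * u] lies in [B], which forces [i] to be a multiple of [p] *)
have hkuB : h (k * u) \in B by rewrite (cong_mem (ch _ nB _ _ kuB)).
have kuiB : (k * u) ^+ i \in B by rewrite -(cong_mem (subsetP sAB_B _ hku)).
have pi : p %| i.
  case: skuD => kup _; apply: dvdn_expg_mem (subsetP sAB_B _ kup) kuiB _.
  by rewrite (cong_mem kuB).
have hkuA : h (k * u) \in A.
  rewrite (cong_mem (subsetP sAB_A _ hku)); case/dvdnP: pi => j ->.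
  by rewrite mulnC expgM groupX // (subsetP sAB_A) //; case: skuD.
by rewrite -(cong_mem (ch _ nA k (k * u) _)) // mulKg.
Qed.

End PrimePowers.

(** * Exponents on central sections *)

Section Centrality.

Variables (gT : finGroupType) (p : nat).
Hypotheses (p_prime : prime p) (pG : p.-group [set: gT]).
Hypothesis cmpG : forall N : {group gT}, N <| [set: gT] ->
  (forall M : {group gT}, M <| [set: gT] -> N \subset M \/ M \subset N) ->
  N :=: 1 \/ N :=: [set: gT].
Hypothesis ncG : ~~ cyclic [set: gT].
Implicit Types (D K M N : {group gT}) (z : gT).

(** Quantifying over all normal [D], instead of the sections inside [N], is what
    makes the property pass to products of normal subgroups. *)
Definition kills_socles (h : gT -> gT) N : Prop :=
  forall D z, D <| [set: gT] -> z \in N -> socle_mod p D z -> h z \in D.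

Lemma incomparable N :
  N <| [set: gT] -> N :!=: 1 -> N :!=: [set: gT] ->
  exists K, [/\ K <| [set: gT], ~~ (N \subset K) & ~~ (K \subset N)].
Proof.
move=> nN N1 NG; apply: contrapT => noK.
have [M nM||] := cmpG nN; last 2 first.
- by move/eqP; rewrite (negPf N1).
- by move/eqP; rewrite (negPf NG).
case: (boolP (N \subset M)) => NM; first by left.
by case: (boolP (M \subset N)) => MN; [right | case: noK; exists M].
Qed.

(** An incomparable [K] provides an element [k] that is independent of a socle
    element [u] of [N] modulo the intersection, and the values at the powers of
    [k] are forced into [N]. Then [N] can be enlarged by [k]: for a socle element
    modulo [D] either its class meets [N], or its image, a power of it modulo
    [D], can lie in [N] only trivially. *)
Lemma kills_socles_extend (h : gT -> gT) N K :
  cp_fun h -> h 1 = 1 -> N <| [set: gT] -> K <| [set: gT] ->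
  ~~ (N \subset K) -> ~~ (K \subset N) -> kills_socles h N ->
  exists N', [/\ N' <| [set: gT], N \proper N' & kills_socles h N'].
Proof.
move=> ch h1 nN nK NK KN killN.
have nI : N :&: K <| [set: gT] by apply: normalI.
have [u [uN uK su]] : exists u, [/\ u \in N, u \notin K & socle_mod p (N :&: K) u].
  have [|u [uN uI su]] := exists_socle_mod p_prime pG nN nI; first by rewrite subsetI subxx.
  by exists u; split=> //; move: uI; rewrite inE uN.
have [k [kK kN sk]] : exists k, [/\ k \in K, k \notin N & socle_mod p (N :&: K) k].
  have [|k [kK kI sk]] := exists_socle_mod p_prime pG nK nI.
    by rewrite subsetI subxx andbT.
  by exists k; split=> //; move: kI; rewrite inE kK andbT.
have huK : h u \in K by apply: subsetP (subsetIr N K) _ (killN _ _ nI uN su).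
have hkN j : h (k ^+ j) \in N.
  apply: (socle_transfer p_prime ch h1 nN nK uN uK su huK).
    exact: groupX.
  exact: socle_mod_exp.
have skN : socle_mod p N k by apply: socle_mod_sub sk; apply: subsetIl.
exists (<[k]> <*> N)%G; split; first exact: cycle_join_normal skN.
  rewrite properE joing_subr; apply/subsetPn; exists k => //.
  by rewrite mem_gen // inE cycle_id.
move=> D z nD zN' sz; have [j zj] := mem_cycle_join nN zN'.
have hzN : h z \in N by rewrite (cong_mem (ch _ nN _ _ zj)).
have nDN : D <*> N <| [set: gT] by apply: normalY.
have [zDN | zDN] := boolP (z \in D <*> N).
  have : z \in D * N.
    by rewrite -norm_joinEl // (subset_trans (subsetT _) (normal_norm nN)).
  case/mulsgP=> d v dD vN dvz.
  have vz : v^-1 * z \in D by rewrite dvz -conjgE normal_conj.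
  rewrite (cong_mem (ch _ nD _ _ vz)); apply: killN => //.
  have -> : v = d^-1 * z by rewrite dvz mulKg.
  by apply: socle_mod_mul => //; apply: socle_mod_in; rewrite ?groupV.
have [i zi] := socle_mod_cp ch h1 nD sz.
have sDJ : D \subset D <*> N := joing_subl _ _.
have sNJ : N \subset D <*> N := joing_subr _ _.
have ziJ : z ^+ i \in D <*> N.
  by rewrite -(cong_mem (subsetP sDJ _ zi)) (subsetP sNJ).
have /dvdnP[q iq] : p %| i.
  by case: sz => zp _; apply: dvdn_expg_mem (subsetP sDJ _ zp) ziJ zDN.
by rewrite (cong_mem zi) iq mulnC expgM groupX //; case: sz.
Qed.

(** As long as [N] is proper, some normal subgroup is incomparable with it, and [N]
    can be enlarged. *)
Lemma kills_socles_all (h : gT -> gT) N :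
  cp_fun h -> h 1 = 1 -> N <| [set: gT] -> N :!=: 1 -> kills_socles h N ->
  forall D z, D <| [set: gT] -> socle_mod p D z -> h z \in D.
Proof.
move=> ch h1; have [n] := ubnP (#|gT| - #|N|).
elim: n N => // n IHn N; rewrite ltnS => le_n nN N1 killN.
have [NG | NG] := eqVneq (N : {set gT}) [set: gT].
  by move=> D z nD; apply: killN; rewrite // NG inE.
have [K [nK NK KN]] := incomparable nN N1 NG.
have [N' [nN' NN' killN']] := kills_socles_extend ch h1 nN nK NK KN killN.
apply: (IHn N') => //.
  apply: leq_trans le_n; apply: ltn_sub2l; last exact: proper_card.
  by apply: leq_trans (proper_card NN') (max_card _).
by apply: contra N1 => /eqP N'1; rewrite -subG1 -N'1 proper_sub.
Qed.

Lemma cp_exp c : cp_fun (fun z : gT => z ^+ c).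
Proof.
move=> N nN x y xy; elim: c => [|c IHc]; first by rewrite !expg0 mulVg group1.
by rewrite !expgS cong_mul.
Qed.

(** A generator [a] of a minimal normal subgroup is mapped to a power [a ^+ c]. The
    group is not cyclic, so there is a second minimal normal subgroup, generated
    by some [b]; comparing [a], [b] and their product shows that the quotient of
    [g] by the power map kills both subgroups, and this spreads to the whole
    group. *)
Lemma socle_exponent (g : gT -> gT) :
  cp_fun g -> g 1 = 1 ->
  exists c, forall D z, D <| [set: gT] -> socle_mod p D z ->
    (z ^+ c)^-1 * g z \in D.
Proof.
move=> cg g1.
have n1 : [1 gT] <| [set: gT] by apply: normal1.
have ntG : ~~ ([set: gT] \subset [1 gT]).
  by apply: contra ncG => /trivgP ->; apply: cyclic1.
have [a [_ a1 sa]] := exists_socle_mod p_prime pG (normal_refl [set: gT]%G) n1 ntG.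
have cyc_normal z : socle_mod p [1 gT] z -> <[z]> <| [set: gT].
  by move=> sz; have := cycle_join_normal n1 sz; rewrite joingG1.
have nA := cyc_normal _ sa.
have [||M [nM aM Ma]] := incomparable nA.
- by rewrite cycle_eq1 -in_set1.
- by apply: contra ncG => /eqP <-; apply: cycle_cyclic.
rewrite cycle_subG in aM.
have AM1 : <[a]> :&: M \subset [1 gT].
  apply/subsetP=> _ /setIP[/cycleP[i ->] aiM]; case: sa => ap _.
  have /dvdnP[q ->] := dvdn_expg_mem p_prime (subsetP (sub1G M) _ ap) aiM aM.
  by rewrite mulnC expgM; apply: (@groupX _ [1 gT]).
have [c ac] := socle_mod_cp cg g1 n1 sa.
have {}ac : g a = a ^+ c.
  by move: ac; rewrite inE -eq_mulVg1 => /eqP.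
exists c => D z nD sz; pose h z := g z * (z ^+ c)^-1.
suff hz : h z \in D by rewrite -(normal_conj _ (z ^+ c)^-1 nD) conjgE invgK -!mulgA mulKVg.
have ch : cp_fun h.
  by move=> N nN x y xy; rewrite cong_mul ?cong_inv ?(cp_exp _ nN) ?cg.
have h1 : h 1 = 1 by rewrite /h g1 expg1n invg1 mulg1.
have ha : h a = 1 by rewrite /h ac mulgV.
have ntM : ~~ (M \subset [1 gT]).
  by apply: contra Ma => /subset_trans; apply; apply: sub1G.
have [b [bM b1 sb]] := exists_socle_mod p_prime pG nM n1 ntM.
have AB w : w \in <[a]> -> w \in <[b]> -> w = 1.
  move=> wa wb; apply/set1P; apply: (subsetP AM1).
  by rewrite inE wa; move: w wb {wa}; apply/subsetP; rewrite cycle_subG.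
have nB := cyc_normal _ sb.
have sub1 D' z' : socle_mod p [1 gT] z' -> socle_mod p D' z'.
  by apply: socle_mod_sub; apply: sub1G.
have aB : a \notin <[b]>.
  by apply: contra aM; apply: subsetP; rewrite cycle_subG.
have bA : b \notin <[a]>.
  by apply: contra b1 => bA; rewrite (AB b bA) ?group1 ?cycle_id.
have hb : h b = 1.
  apply: AB; last by apply: (cp_mem ch h1 nB); apply: cycle_id.
  apply: (socle_transfer p_prime ch h1 nA nB (cycle_id a) aB);
    by rewrite ?ha ?cycle_id //; try exact: sub1.
have killA : kills_socles h <[a]>.
  move=> D' z' nD' z'A _; suff -> : h z' = 1 by apply: group1.
  apply: AB; first exact: (cp_mem ch h1 nA).
  apply: (socle_transfer p_prime ch h1 nB nA (cycle_id b) bA); rewrite ?hb //; try exact: sub1.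
  by apply: sub1; case/cycleP: z'A => i ->; apply: socle_mod_exp.
apply: (kills_socles_all ch h1 nA _ killA) => //.
by rewrite cycle_eq1 -in_set1.
Qed.

Lemma maximal_socle_mod M z : maximal M [set: gT] -> socle_mod p M z.
Proof.
move=> maxM; have nM := p_maximal_normal pG maxM; have iM := p_maximal_index pG maxM.
have nMx x : x \in 'N(M) by apply: (subsetP (normal_norm nM)); rewrite inE.
have oQ : #|[set: gT] / M| = p by rewrite card_quotient ?normal_norm.
have inQ x : coset M x \in [set: gT] / M by apply: mem_quotient; rewrite inE.
split=> [|g].
  by apply: coset_idr; rewrite ?nMx // morphX ?nMx //= -oQ expg_cardG.
apply: coset_idr; first exact: nMx.
rewrite morphR ?nMx //=; apply/eqP/commgP.
have abQ : abelian ([set: gT] / M) by apply/cyclic_abelian/prime_cyclic; rewrite oQ.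
exact: (centsP abQ).
Qed.

(** The cyclic subgroup of an element outside one maximal subgroup is proper, hence
    lies in another maximal subgroup. *)
Lemma two_maximal : exists M1 M2 : {group gT},
  [/\ maximal M1 [set: gT], maximal M2 [set: gT] & M1 * M2 = [set: gT]].
Proof.
have [e1|[M1 max1 _]] := maximal_exists (sub1G [set: gT]).
  by case/negP: ncG; rewrite -e1 cyclic1.
have nM1 := p_maximal_normal pG max1.
have [z _ zM1] : exists2 z, z \in [set: gT] & z \notin M1.
  by have /maxgroupp/properP[_ [z zG zM]] := max1; exists z.
have [eZ|[M2 max2 zM2]] := maximal_exists (subsetT <[z]>).
  by case/negP: ncG; rewrite -eZ cycle_cyclic.
exists M1, M2; split=> //; apply: mulg_normal_maximal => //; first exact: subsetT.
by apply: contra zM1 => /subsetP; apply; rewrite -cycle_subG.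
Qed.

Definition shift k (i : 'I_k) z (x : k.-tuple gT) : k.-tuple gT :=
  [tuple if j == i then tnth x j * z else tnth x j | j < k].

Lemma shift1 k (i : 'I_k) x : shift i 1 x = x.
Proof.
by apply: eq_from_tnth => j; rewrite tnth_mktuple mulg1 if_same.
Qed.

Lemma shift_cong N k (i : 'I_k) z z' (x y : k.-tuple gT) :
  N <| [set: gT] -> z^-1 * z' \in N ->
  (forall j, (tnth x j)^-1 * tnth y j \in N) ->
  forall j, (tnth (shift i z x) j)^-1 * tnth (shift i z' y) j \in N.
Proof.
by move=> nN zz' xy j; rewrite !tnth_mktuple; case: ifP; rewrite // cong_mul.
Qed.

(** The exponent does not depend on the point: it is seen on the factor group of
    a maximal subgroup, hence is constant modulo that subgroup, and two maximal
    subgroups generate the whole group. *)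
Lemma coordinate_exponent k (f : operation gT k) (i : 'I_k) :
  congruence_preserving f ->
  exists c, forall (x : k.-tuple gT) D z, D <| [set: gT] -> socle_mod p D z ->
    (f x * z ^+ c)^-1 * f (shift i z x) \in D.
Proof.
move/congruence_preservingP=> cf.
have refl N a : a^-1 * a \in N by rewrite mulVg group1.
have expx x : exists c, forall D z, D <| [set: gT] -> socle_mod p D z ->
    (z ^+ c)^-1 * ((f x)^-1 * f (shift i z x)) \in D.
  apply: socle_exponent; last by rewrite shift1 mulVg.
  by move=> N nN z z' zz'; rewrite cong_mul // cf // => j; apply: shift_cong.
have [c cP] := choice expx.
have [M1 [M2 [max1 max2 M12]]] := two_maximal.
have c_max (M : {group gT}) x y : maximal M [set: gT] ->
    (forall j, (tnth x j)^-1 * tnth y j \in M) -> c x = c y %[mod p].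
  move=> maxM xy; have nM := p_maximal_normal pG maxM.
  have [z _ zM] : exists2 z, z \in [set: gT] & z \notin M.
    by have /maxgroupp/properP[_ [z zG zM]] := maxM; exists z.
  have sz := maximal_socle_mod z maxM; have [zp _] := sz.
  apply: eqn_mod_expg zp zM _ => //.
  apply: cong_trans (cP x M z nM sz) _.
  apply: cong_trans (cong_sym (cP y M z nM sz)).
  by rewrite cong_mul ?cong_inv ?cf // => j; apply: shift_cong.
have c_const x y : c x = c y %[mod p].
  have split_xy j : exists w : gT,
      ((tnth x j)^-1 * w \in M1) && (w^-1 * tnth y j \in M2).
    have /mulsgP[a b aM bM ab] : (tnth x j)^-1 * tnth y j \in M1 * M2 by rewrite M12 inE.
    by exists (tnth x j * a); rewrite mulKg aM invMg -mulgA ab mulKg.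
  have [w wP] := fin_all_exists split_xy.
  transitivity (c [tuple w j | j < k] %% p).
    by apply: c_max max1 _ => j; rewrite tnth_mktuple; case/andP: (wP j).
  by apply: c_max max2 _ => j; rewrite tnth_mktuple; case/andP: (wP j).
exists (c [tuple 1 | _ < k]) => x D z nD sz; rewrite invMg -mulgA.
apply: cong_trans (cP x D z nD sz).
by case: sz => zp _; apply: expg_eqn_mod zp _ => //; apply: c_const.
Qed.

End Centrality.

(** * Sums of functions of few variables *)

Section Juntas.

Local Open Scope ring_scope.
Import GRing.Theory.

Variables (T : finType) (R : comNzRingType) (k : nat).
Implicit Types (h : k.-tuple T -> R) (S : {set 'I_k}).

Definition depends_on S h : Prop :=
  forall x y, (forall i, i \in S -> tnth x i = tnth y i) -> h x = h y.

Inductive junta_sum (d : nat) : (k.-tuple T -> R) -> Prop :=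
| JuntaBase h S : (#|S| <= d)%N -> depends_on S h -> junta_sum d h
| JuntaAdd h h1 h2 : junta_sum d h1 -> junta_sum d h2 ->
    (forall x, h x = h1 x + h2 x) -> junta_sum d h.

Lemma junta_const d c : junta_sum d (fun=> c).
Proof. by apply: (@JuntaBase _ _ set0); rewrite ?cards0. Qed.

Lemma junta_ext d h h' : h =1 h' -> junta_sum d h -> junta_sum d h'.
Proof.
move=> hh' jh; apply: JuntaAdd jh (junta_const d 0) _ => x.
by rewrite addr0.
Qed.

Lemma junta_add d h h' :
  junta_sum d h -> junta_sum d h' -> junta_sum d (fun x => h x + h' x).
Proof. by move=> jh jh'; apply: JuntaAdd jh jh' _. Qed.

Lemma junta_leq d d' h : (d <= d')%N -> junta_sum d h -> junta_sum d' h.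
Proof.
move=> le_dd'; elim=> {h} [h S cS hS|h h1 h2 _ j1 _ j2 eh]; last exact: JuntaAdd eh.
by apply: JuntaBase hS; apply: leq_trans le_dd'.
Qed.

Lemma junta_mul d d' h h' :
  junta_sum d h -> junta_sum d' h' -> junta_sum (d + d') (fun x => h x * h' x).
Proof.
move=> jh; elim=> {h'} [h' S' cS' hS'|h' h1 h2 _ j1 _ j2 eh']; last first.
  by apply: JuntaAdd j1 j2 _ => x; rewrite eh' mulrDr.
elim: jh => {h} [h S cS hS|h h1 h2 _ j1 _ j2 eh]; last first.
  by apply: JuntaAdd j1 j2 _ => x; rewrite eh mulrDl.
apply: (@JuntaBase _ _ (S :|: S')) => [|x y xy].
  by rewrite cardsU (leq_trans (leq_subr _ _)) // leq_add.
by congr (_ * _); [apply: hS | apply: hS'] => i iS; apply: xy; rewrite inE iS ?orbT.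
Qed.

Lemma junta_scale d c h : junta_sum d h -> junta_sum d (fun x => c * h x).
Proof. by move=> jh; rewrite -[d]add0n; apply: junta_mul (junta_const 0 c) jh. Qed.

Lemma junta_bigsum d (I : Type) (r : seq I) (h : I -> k.-tuple T -> R) :
  (forall i, junta_sum d (h i)) -> junta_sum d (fun x => \sum_(i <- r) h i x).
Proof.
move=> jh; elim: r => [|i r IHr].
  by apply: junta_ext (junta_const d 0) => x; rewrite big_nil.
by apply: JuntaAdd (jh i) IHr _ => x; rewrite big_cons.
Qed.

Lemma junta_bigprod d (I : Type) (r : seq I) (h : I -> k.-tuple T -> R) :
  (forall i, junta_sum d (h i)) ->
  junta_sum (size r * d) (fun x => \prod_(i <- r) h i x).
Proof.
move=> jh; elim: r => [|i r IHr].
  by apply: junta_ext (junta_const _ 1) => x; rewrite big_nil.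
by apply: junta_ext (junta_mul (jh i) IHr) => x; rewrite big_cons.
Qed.

Lemma junta_exp d n h : junta_sum d h -> junta_sum (n * d) (fun x => h x ^+ n).
Proof.
move=> jh; elim: n => [|n IHn].
  by apply: junta_ext (junta_const _ 1) => x; rewrite expr0.
by apply: junta_ext (junta_mul jh IHn) => x; rewrite exprS.
Qed.

(** Every function of [n] finite-valued arguments is a polynomial of degree at
    most [n] in the indicators of the values of these arguments. *)
Lemma junta_comp d n (U : finType) (u : 'I_n -> k.-tuple T -> U)
    (Q : n.-tuple U -> R) :
  (forall i a, junta_sum d (fun x => (u i x == a)%:R)) ->
  junta_sum (n * d) (fun x => Q [tuple u i x | i < n]).
Proof.
move=> ju.
have jt (t : n.-tuple U) :
    junta_sum (n * d) (fun x => Q t * \prod_(i < n) (u i x == tnth t i)%:R).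
  apply: junta_scale.
  have := junta_bigprod (enum 'I_n) (fun i => ju i (tnth t i)).
  rewrite size_enum_ord; apply: junta_ext => x.
  by rewrite big_enum.
have := junta_bigsum (enum {: n.-tuple U}) jt; apply: junta_ext => x.
rewrite big_enum /= (bigD1 [tuple u i x | i < n]) //= [X in _ * X]big1 => [|i _]; last first.
  by rewrite tnth_mktuple eqxx.
rewrite mulr1 big1 ?addr0 // => t neq_t; case: (pickP (fun i => u i x != tnth t i)) => [i ui|eq_u].
  by rewrite (bigD1 i) //= (negPf ui) mul0r mulr0.
case/eqP: neq_t; apply: eq_from_tnth => i; rewrite tnth_mktuple.
by have /negbFE/eqP := eq_u i.
Qed.

(** The alternating sum over the vertices of a cube of dimension [k] annihilates
    every function that ignores a coordinate. *)
Lemma junta_alternating_sum d h a b : (d < k)%N -> junta_sum d h ->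
  \sum_(B : {set 'I_k}) (-1) ^+ #|B| * h [tuple if i \in B then a else b | i < k] = 0.
Proof.
move=> dk; elim=> {h} [h S cS hS|h h1 h2 _ e1 _ e2 eh]; last first.
  rewrite (eq_bigr _ (fun B _ => congr1 _ (eh _))).
  by under eq_bigr do rewrite mulrDr; rewrite big_split /= e1 e2 addr0.
have [i iS] : exists i, i \notin S.
  apply/existsP; rewrite -negb_forall; apply/negP=> /forallP allS.
  move: (leq_ltn_trans cS dk); rewrite (_ : S = [set: 'I_k]) ?cardsT ?card_ord ?ltnn //.
  by apply/setP=> i; rewrite inE allS.
rewrite (bigID (fun B : {set 'I_k} => i \in B)) /=.
rewrite (reindex_onto (fun B => i |: B) (fun B => B :\ i)) /=; last first.
  by move=> B iB; rewrite setD1K.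
rewrite (eq_bigl (fun B : {set 'I_k} => i \notin B)) => [|B]; last first.
  rewrite setU11 /=; apply/eqP/idP => [<-|iB]; first by rewrite !inE eqxx.
  by rewrite setU1K.
rewrite -big_split big1 //= => B iB.
rewrite cardsU1 iB exprS mulN1r mulNr addrC; apply/eqP; rewrite subr_eq0; apply/eqP.
congr (_ * _); apply: hS => j jS; rewrite !tnth_mktuple !inE.
by case: eqP => // ji; rewrite -ji jS in iS.
Qed.

End Juntas.

(** * The degree of generated operations *)

Section GeneratedOperations.

Variables (T : finType) (F : opset T).

(** Reassociating compositions, a generated operation is a projection or has a
    generator as its outermost operation. *)
Lemma generated_outermost (P : forall k, operation T k -> Prop) :
  (forall k (i : 'I_k), P k (proj T i)) ->
  (forall n (f : operation T n) k (g : 'I_n -> operation T k),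
     F f -> (forall i, Defs.generated F (g i)) -> (forall i, P k (g i)) ->
     P k (Defs.comp f g)) ->
  forall k (f : operation T k), Defs.generated F f -> P k f.
Proof.
move=> Pproj Pcomp.
pose Q n (f : operation T n) := forall k (g : 'I_n -> operation T k),
  (forall i, Defs.generated F (g i)) -> (forall i, P k (g i)) ->
  Defs.generated F (Defs.comp f g) /\ P k (Defs.comp f g).
have Qgen n (f : operation T n) : Defs.generated F f -> Q n f.
  elim=> {n f} [n f Ff|n i|n k f g _ Qf _ Qg] l h genh Ph.
  - by split; [apply: generated_comp genh; apply: generated_mem | apply: Pcomp].
  - rewrite (_ : Defs.comp _ _ = h i); first by split.
    by apply/ffunP=> x; rewrite !ffunE tnth_mktuple.
  have -> : Defs.comp (Defs.comp f g) h = Defs.comp f (fun i => Defs.comp (g i) h).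
    apply/ffunP=> x; rewrite !ffunE; congr (f _); apply: eq_from_tnth => i.
    by rewrite !tnth_mktuple ffunE.
  by apply: Qf => i; have [] := Qg i _ h genh Ph.
move=> k f /Qgen Qf; have [||_] := Qf k (fun i => proj T i).
- by move=> i; apply: generated_proj.
- by move=> i; apply: Pproj.
congr (P k _); apply/ffunP=> x; rewrite ffunE; congr (f _).
by apply: eq_from_tnth => i; rewrite tnth_mktuple ffunE.
Qed.

End GeneratedOperations.

Section DegreeBound.

Variables (gT : finGroupType) (p : nat).
Hypotheses (p_prime : prime p) (pG : p.-group [set: gT]).
Hypothesis cmpG : forall N : {group gT}, N <| [set: gT] ->
  (forall M : {group gT}, M <| [set: gT] -> N \subset M \/ M \subset N) ->
  N :=: 1 \/ N :=: [set: gT].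
Hypothesis ncG : ~~ cyclic [set: gT].
Variable F : seq {k : nat & operation gT k}.
Hypothesis cpF : forall u, u \in F -> congruence_preserving (tagged u).
Implicit Types (N : {group gT}) (z : gT).

Let gen k (f : operation gT k) :=
  Defs.generated (fun n (g : operation gT n) => Tagged (operation gT) g \in F) f.

(** Functions on the quotient by [N] with values in the prime field, seen on the
    group. *)
Definition invariant N (phi : gT -> 'F_p) : Prop :=
  forall x y, x^-1 * y \in N -> phi x = phi y.

Definition degree_le N d k (f : operation gT k) : Prop :=
  forall phi, invariant N phi -> junta_sum d (fun x : k.-tuple gT => phi (f x)).

Definition bounded_degree N : Prop :=
  exists d, forall k (f : operation gT k), gen f -> degree_le N d f.

Definition class_repr N x := repr (x *: N).

Lemma class_repr_cong N x : (class_repr N x)^-1 * x \in N.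
Proof.
by apply: cong_sym; have := mem_repr x (lcoset_refl N x); rewrite mem_lcoset.
Qed.

Lemma class_repr_eq N x y : x^-1 * y \in N -> class_repr N x = class_repr N y.
Proof. by move=> xy; congr repr; apply: lcoset_eqP; rewrite mem_lcoset cong_sym. Qed.

Lemma Fp_nat_eq m n : m = n %[mod p] -> (m%:R = n%:R :> 'F_p)%R.
Proof. by move=> mn; rewrite -(Fp_nat_mod p_prime m) mn Fp_nat_mod. Qed.

(** A coordinate on the cosets of [N] within the cosets of [<[z0]> <*> N],
    additive along the central section between these two subgroups. *)
Lemma exists_coordinate N z0 :
  N <| [set: gT] -> socle_mod p N z0 -> z0 \notin N ->
  exists kappa : gT -> 'F_p,
    (forall x z j, (z0 ^+ j)^-1 * z \in N -> kappa (x * z) = (kappa x + j%:R)%R) /\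
    (forall x y, x^-1 * y \in <[z0]> <*> N -> kappa x = kappa y -> x^-1 * y \in N).
Proof.
move=> nN sz z0N; pose N1 := (<[z0]> <*> N)%G; have [z0p _] := sz.
have exj x : exists j, (z0 ^+ j)^-1 * ((class_repr N1 x)^-1 * x) \in N.
  by apply: mem_cycle_join => //; apply: class_repr_cong.
have [j jP] := choice exj.
have kP x z i : (z0 ^+ i)^-1 * z \in N ->
    ((j (x * z)%g)%:R = (j x)%:R + i%:R :> 'F_p)%R.
  move=> zi; rewrite -GRing.natrD; apply: Fp_nat_eq.
  apply: (eqn_mod_expg p_prime z0p z0N).
  have -> : z0 ^+ (j x + i) = z0 ^+ j x * z0 ^+ i by rewrite expgD.
  apply: cong_trans (jP (x * z)) (cong_sym _).
  have <- : class_repr N1 x = class_repr N1 (x * z).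
    apply: class_repr_eq; rewrite mulKg -(mulKVg (z0 ^+ i) z) groupM //.
      by rewrite groupX // mem_gen // inE cycle_id.
    by apply: subsetP zi; apply: joing_subr.
  by rewrite (mulgA _ x z); apply: cong_mul (jP x) zi.
exists (fun x => (j x)%:R%R); split=> // x y xy.
have [i zi] := mem_cycle_join nN xy.
rewrite -(mulKVg x y) (kP _ _ _ zi) mulKg => /esym/eqP.
rewrite -[X in _ == X]GRing.addr0 (inj_eq (GRing.addrI _)) => /eqP i0.
rewrite (cong_mem zi).
have /dvdnP[q ->] : p %| i.
  have := congr1 (@nat_of_ord _) i0; rewrite val_Fp_nat //= => /eqP.
  by rewrite /dvdn.
by rewrite mulnC expgM groupX.
Qed.

Lemma shift_invariant k (q : k.-tuple gT -> 'F_p) N :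
  (forall i z x, z \in N -> q (shift i z x) = q x) ->
  forall x y, (forall i, (tnth x i)^-1 * tnth y i \in N) -> q x = q y.
Proof.
move=> qs x y xy.
have agree (s : seq 'I_k) : forall x, (forall i, (tnth x i)^-1 * tnth y i \in N) ->
    (forall i, i \notin s -> tnth x i = tnth y i) -> q x = q y.
  elim: s => [|i s IHs] {x xy} x xy eq_xy.
    by congr q; apply: eq_from_tnth => i; apply: eq_xy.
  rewrite -(qs i ((tnth x i)^-1 * tnth y i)) //; apply: IHs => j.
    rewrite tnth_mktuple; case: eqP => [->|_] //.
    by rewrite mulKVg mulVg group1.
  move=> js; rewrite tnth_mktuple; case: eqP => [->|/eqP ji]; first by rewrite mulKVg.
  by apply: eq_xy; rewrite inE negb_or ji.
by apply: (agree (enum 'I_k)) => // i; rewrite mem_enum.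
Qed.

Local Open Scope ring_scope.
Import GRing.Theory.

(** Applied to an operation with a generator [f] outermost, the coordinate [kappa]
    is a combination with constant coefficients of the coordinates of the inner
    operations plus a function of their classes modulo the larger subgroup. The
    first part does not raise the degree, and the degree of the second part is
    bounded by the largest arity of a generator times the degree known one step
    higher in the series. *)
Lemma bounded_degree_step N z0 :
  N <| [set: gT] -> socle_mod p N z0 -> z0 \notin N ->
  bounded_degree (<[z0]> <*> N)%G -> bounded_degree N.
Proof.
move=> nN sz z0N [d dP]; set N1 := (<[z0]> <*> N)%G in dP.
have [kappa [kappaD kappa_inj]] := exists_coordinate nN sz z0N.
pose m := \max_(u <- F) tag u; pose d' := maxn 1 (m * d).
have repr_junta k (f : operation gT k) a : gen f ->
    junta_sum d (fun x : k.-tuple gT => (class_repr N1 (f x) == a)%:R : 'F_p).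
  move=> genf; apply: (dP _ _ genf (fun y => (class_repr N1 y == a)%:R)) => x y xy.
  by rewrite (class_repr_eq xy).
have kappa_junta : forall k (f : operation gT k), gen f ->
    junta_sum d' (fun x : k.-tuple gT => kappa (f x)).
  apply: generated_outermost => [k i|n f k g Ff geng jg].
    apply: (@JuntaBase _ _ _ _ _ [set i]); first by rewrite cards1 leq_maxl.
    by move=> x y xy; rewrite !ffunE xy ?set11.
  have cf : congruence_preserving f := cpF Ff.
  have [c cP] := fin_all_exists (fun i => coordinate_exponent p_prime pG cmpG ncG i cf).
  (* the remainder of [kappa \o f] depends only on the classes modulo [N1] *)
  pose q (t : n.-tuple gT) := kappa (f t) - \sum_(i < n) (c i)%:R * kappa (tnth t i).
  have q_shift i z t : z \in N1 -> q (shift i z t) = q t.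
    move=> zN1; have [j zj] := mem_cycle_join nN zN1.
    have szz : socle_mod p N z.
      rewrite -(mulKVg (z0 ^+ j)%g z); apply: socle_mod_mul => //.
        exact: socle_mod_exp.
      exact: socle_mod_in.
    have fz := cP i t N z nN szz.
    have kf : kappa (f (shift i z t)) = kappa (f t) + (j * c i)%:R.
      rewrite -(mulKVg (f t) (f (shift i z t))); apply: kappaD.
      rewrite expgM; apply: cong_trans (cp_exp (c i) nN zj) _.
      by rewrite mulgA -invMg.
    have eq_rest : \sum_(l < n | l != i) (c l)%:R * kappa (tnth (shift i z t) l) =
        \sum_(l < n | l != i) (c l)%:R * kappa (tnth t l).
      by apply: eq_bigr => l /negPf li; rewrite tnth_mktuple li.
    rewrite /q kf (bigD1 i) //= [in RHS](bigD1 i) //= eq_rest tnth_mktuple eqxx.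
    by rewrite (kappaD _ _ _ zj) natrM; ring.
  have q_repr t : q t = q [tuple class_repr N1 (tnth t i) | i < n].
    apply: (shift_invariant q_shift) => i; rewrite tnth_mktuple.
    exact/cong_sym/class_repr_cong.
  have n_m : (n <= m)%N by exact: (@leq_bigmax_seq _ F xpredT (fun u => tag u) _ Ff isT).
  have jq : junta_sum d' (fun x : k.-tuple gT => q [tuple g i x | i < n]).
    have jr := junta_comp q (fun i a => repr_junta k (g i) a (geng i)).
    apply: junta_leq (junta_ext _ jr) => [|x].
      by rewrite leq_max leq_mul2r n_m !orbT.
    rewrite [RHS]q_repr; congr q; apply: eq_from_tnth => i.
    by rewrite !tnth_mktuple.
  have jl : junta_sum d' (fun x : k.-tuple gT => \sum_(i < n) (c i)%:R * kappa (g i x)).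
    by apply: junta_bigsum => i; apply: junta_scale.
  apply: junta_ext (junta_add jq jl) => x; rewrite ffunE /q.
  rewrite [X in _ - X](eq_bigr (fun i => (c i)%:R * kappa (g i x))) ?subrK // => i _.
  by rewrite tnth_mktuple.
exists (d + p.-1 * d')%N => k f genf phi phiN.
(* Fermat's little theorem turns the indicators of [kappa] into polynomials *)
have kappa_ind a : junta_sum (p.-1 * d') (fun x : k.-tuple gT => (kappa (f x) == a)%:R : 'F_p).
  have jka : junta_sum d' (fun x : k.-tuple gT => kappa (f x) + - a).
    exact: junta_add (kappa_junta _ _ genf) (junta_const _ _ _ _).
  have jk1 := junta_scale (-1) (junta_exp p.-1 jka).
  apply: junta_ext (junta_add (junta_const gT k _ 1) jk1) => x.
  case: eqP => [->|/eqP neq].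
    by rewrite subrr expr0n -subn1 subn_eq0 leqNgt prime_gt1 //= mulr0 addr0.
  suff -> : (kappa (f x) - a) ^+ p.-1 = 1 by rewrite mulr1 subrr.
  rewrite -subr_eq0 in neq; apply: (mulfI neq); rewrite -exprS prednK ?prime_gt0 //.
  by rewrite mulr1 -{2}(expf_card (kappa (f x) - a)) card_Fp.
pose Phi t a := if [pick y | (class_repr N1 y == t) && (kappa y == a)] is Some y then phi y else 0.
have PhiE y : phi y = Phi (class_repr N1 y) (kappa y).
  rewrite /Phi; case: pickP => [w /andP[/eqP rw /eqP kw]|/(_ y)]; last by rewrite !eqxx.
  apply: phiN; apply: kappa_inj => //.
  apply: cong_trans (cong_sym (class_repr_cong N1 y)) _.
  by rewrite -rw; apply: class_repr_cong.
have jPhi ta : junta_sum (d + p.-1 * d') (fun x : k.-tuple gT =>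
    Phi ta.1 ta.2 * ((class_repr N1 (f x) == ta.1)%:R * (kappa (f x) == ta.2)%:R)).
  by apply: junta_scale; apply: junta_mul; [apply: repr_junta | apply: kappa_ind].
apply: junta_ext (junta_bigsum (enum {: gT * 'F_p}) jPhi) => x.
rewrite big_enum (bigD1 (class_repr N1 (f x), kappa (f x))) //= !eqxx !mulr1 -PhiE.
rewrite big1 ?addr0 // => -[t a]; rewrite xpair_eqE /=.
by rewrite ![t == _]eq_sym ![a == _]eq_sym; do 2![case: eqP => _ //=]; rewrite ?mul0r ?mulr0.
Qed.

Lemma bounded_degree_all N : N <| [set: gT] -> bounded_degree N.
Proof.
have [n] := ubnP (#|gT| - #|N|).
elim: n N => // n IHn N; rewrite ltnS => le_n nN.
have [sGN | sGN] := boolP ([set: gT] \subset N).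
  exists 0 => k f _ phi phiN.
  apply: junta_ext (junta_const _ _ _ (phi 1%g)) => x; apply: phiN.
  by apply: (subsetP sGN); rewrite inE.
have [z [_ zN sz]] := exists_socle_mod p_prime pG (normal_refl [set: gT]%G) nN sGN.
apply: (bounded_degree_step nN sz zN); apply: IHn; last exact: cycle_join_normal nN sz.
have NN1 : N \proper (<[z]> <*> N)%G.
  rewrite properE joing_subr; apply/subsetPn; exists z => //.
  by rewrite mem_gen // inE cycle_id.
apply: leq_trans le_n; apply: ltn_sub2l; last exact: proper_card.
by apply: leq_trans (proper_card NN1) (max_card _).
Qed.

End DegreeBound.


Section SplitLattice.

Variables (gT : finGroupType) (E D : {group gT}).
Hypothesis splitED : forall I : {group gT}, I <| [set: gT] ->
  E \subset I \/ I \subset D.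

Definition split_operation (e : gT) k : operation gT k :=
  [ffun x => if [forall i, tnth x i \notin D] then e else 1].

(** Modulo a normal subgroup containing [E] all values agree, and modulo one inside
    [D] the arguments determine the value. *)
Lemma split_operation_cp e k : e \in E -> congruence_preserving (split_operation e k).
Proof.
move=> eE; apply/congruence_preservingP=> I nI x y xy; rewrite !ffunE.
have [sEI | sID] := splitED nI.
  have eI := subsetP sEI e eE.
  by do 2!case: ifP => _; rewrite ?groupM ?groupV.
suff -> : [forall i, tnth x i \notin D] = [forall i, tnth y i \notin D].
  by rewrite mulVg group1.
by apply: eq_forallb => i; rewrite (cong_mem (subsetP sID _ (xy i))).
Qed.

End SplitLattice.

Section FiniteGeneration.

Variables (gT : finGroupType) (p : nat).
Hypotheses (p_prime : prime p) (pG : p.-group [set: gT]).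
Hypothesis cmpG : forall N : {group gT}, N <| [set: gT] ->
  (forall M : {group gT}, M <| [set: gT] -> N \subset M \/ M \subset N) ->
  N :=: 1 \/ N :=: [set: gT].

Lemma split_not_finitely_generated (E D : {group gT}) :
  ~~ cyclic [set: gT] -> E :!=: 1 -> D :!=: [set: gT] ->
  (forall I : {group gT}, I <| [set: gT] -> E \subset I \/ I \subset D) ->
  ~ finitely_generated (@congruence_preserving_functions gT).
Proof.
move=> ncG ntE DG splitED [F [FC genF]].
have cpF u : u \in F -> congruence_preserving (tagged u) by case/FC.
have [d dP] := bounded_degree_all p_prime pG cmpG ncG cpF (normal1 [set: gT]%G).
have [e eE e1] := trivgPn _ ntE.
have [g gD] : exists g, g \notin D.
  have /properP[_ [g _ gD]] : D \proper [set: gT] by rewrite properEneq DG subsetT.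
  by exists g.
pose f := split_operation D e d.+1.
have genf := genF _ f (conj isT (split_operation_cp splitED eE)).
have inv1 : invariant (p := p) 1%G (fun y : gT => (y == e)%:R%R).
  by move=> x y; rewrite inE -eq_mulVg1 => /eqP ->.
(* only the vertex of the cube all of whose coordinates are [g] contributes *)
have := junta_alternating_sum g 1 (ltnSn d) (dP _ _ genf _ inv1).
rewrite (bigD1 [set: 'I_d.+1]) //= [X in (_ + X)%R]big1 => [|B BT].
  rewrite GRing.addr0 ffunE (_ : [forall i, _]) ?eqxx ?GRing.mulr1.
    by move/eqP; rewrite GRing.signr_eq0.
  by apply/forallP=> i; rewrite tnth_mktuple inE.
have /subsetPn[i _ iB] : ~~ ([set: 'I_d.+1] \subset B) by rewrite subTset.
rewrite ffunE (_ : [forall i, _] = false) ?[1 == e]eq_sym ?(negPf e1) ?GRing.mulr0 //.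
by apply/negbTE/forallPn; exists i; rewrite tnth_mktuple (negPf iB) group1.
Qed.

(** The normal subgroups of a cyclic [p]-group form a chain, so all of them are
    comparable to each other and only the two trivial ones exist. *)
Lemma cyclic_finitely_generated : cyclic [set: gT] ->
  finitely_generated (@congruence_preserving_functions gT).
Proof.
move=> cG; apply: (@finitely_generated_upto _ 2) => k f k_gt2 _.
apply: term_simple (ltnW (ltnW k_gt2)) => // n h.
apply/congruence_preservingP=> N nN x y xy.
have [M nM|N1|->] := cmpG nN; last by rewrite inE.
  have le_sub (A B : {group gT}) : logn p #|A| <= logn p #|B| -> A \subset B.
    move=> le_AB; rewrite -(cardSg_cyclic cG) ?subsetT //.
    rewrite (card_pgroup (pgroupS (subsetT A) pG)) (card_pgroup (pgroupS (subsetT B) pG)).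
    exact: dvdn_exp2l.
  by case/orP: (leq_total (logn p #|N|) (logn p #|M|)) => /le_sub; [left | right].
suff -> : x = y by rewrite mulVg group1.
apply: eq_from_tnth => i; apply/eqP; rewrite eq_mulVg1 -in_set1.
by have := xy i; rewrite N1.
Qed.

End FiniteGeneration.

Theorem theorem1p3 (gT : finGroupType) (p : nat) (p_prime : prime p)
    (pG : p.-group [set: gT])
    (cmpG : forall N : {group gT}, N <| [set: gT] ->
       (forall M : {group gT}, M <| [set: gT] -> N \subset M \/ M \subset N) ->
       N :=: 1 \/ N :=: [set: gT]) :
  ~ finitely_generated (@congruence_preserving_functions gT) <->
  ~~ cyclic [set: gT] /\
  exists E D : {group gT},
    [/\ E <| [set: gT], D <| [set: gT], E :!=: 1, D :!=: [set: gT]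
      & forall I : {group gT}, I <| [set: gT] -> E \subset I \/ I \subset D].
Proof.
split=> [nfg | [ncG [E [D [nE nD ntE DG splitED]]]]]; last first.
  exact: split_not_finitely_generated p_prime pG cmpG _ _ ncG ntE DG splitED.
split; first by apply/negP=> /(cyclic_finitely_generated pG cmpG).
by apply: contrapT => /not_split_finitely_generated.
Qed.
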